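(* Let $d\ge 2$ and let $(\mathcal{H}_1,\mathcal{H}_2,\dots,\mathcal{H}_d)$ be a $d$-partition of $K_{3d}^3$ such that $det^{S^3}(\omega_{(\mathcal{H}_1,\mathcal{H}_2,\dots,\mathcal{H}_d)})\neq 0$. Then $(\mathcal{H}_1,\mathcal{H}_2,\dots,\mathcal{H}_d)$ is a homogeneous $d$-partition.
   Context: $k$ is a field of characteristic zero, $\otimes=\otimes_k$, and $V_d$ is a $k$-vector space of dimension $d$ with basis $\{e_1,\dots,e_d\}$. Definition of $det^{S^3}$. Given $v_{i,j,l}\in V_d$ for $1\leq i<j<l\leq 3d$, for each $1\leq m<n\leq 3d$ let $\mathcal{E}_{m,n}$ be the vector equation (with scalar unknowns $\lambda_{i,j,l}$) $$\sum_{r=1}^{m-1}(-1)^{r-1}\lambda_{r,m,n}v_{r,m,n}+\sum_{s=m+1}^{n-1}(-1)^s\lambda_{m,s,n}v_{m,s,n}+\sum_{t=n+1}^{3d}(-1)^{t+1}\lambda_{m,n,t}v_{m,n,t}=0.$$ In the basis $e_1,\dots,e_d$ each $\mathcal{E}_{m,n}$ is a block of $d$ scalar linear equations. Let $A_{3d}((v_{i,j,l}))$ be the $d\binom{3d-1}{2}\times d\binom{3d-1}{2}$ coefficient matrix of the system of the equations $\mathcal{E}_{m,n}$ with $1\leq m<n<3d$ (columns indexed by triples, row blocks by pairs, in lexicographic order). Then $det^{S^3}:V_d^{\otimes\binom{3d}{3}}\to k$ is the linear map with $det^{S^3}(\otimes_{1\leq i<j<l\leq 3d}(v_{i,j,l}))=\det(A_{3d}((v_{i,j,l})))$.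 Hypergraphs. $K_{n}^3$ is the complete $3$-uniform hypergraph with vertex set $\{1,\dots,n\}$, whose hyperedges are all $3$-element subsets. A $d$-partition of $K_{3d}^3$ is an ordered tuple $(\mathcal{H}_1,\dots,\mathcal{H}_d)$ of sub-hypergraphs, each with vertex set $\{1,\dots,3d\}$, whose hyperedge sets $E(\mathcal{H}_i)$ are pairwise disjoint with union the set of all hyperedges of $K_{3d}^3$. The element $\omega_{(\mathcal{H}_1,\dots,\mathcal{H}_d)}\in V_d^{\otimes\binom{3d}{3}}$ is the simple tensor $\otimes_{1\leq i<j<l\leq 3d}(v_{i,j,l})$ with $v_{i,j,l}=e_q$ where $q$ is the unique index with $\{i,j,l\}\in E(\mathcal{H}_q)$. For a sub-hypergraph $\mathcal{H}$ of $K_n^3$ and $1\le s\le 3$, $E_s(\mathcal{H})$ is the set of $s$-element subsets of vertices contained in some hyperedge of $\mathcal{H}$. A $d$-partition of $K_{3d}^3$ is pre-homogeneous if $|E_1(\mathcal{H}_i)|=3d$ and $|E_2(\mathcal{H}_i)|=\frac{3d(3d-1)}{2}$ for all $1\le i\le d$; it is homogeneous if it is pre-homogeneous and $|E_3(\mathcal{H}_i)|=\frac{(3d-1)(3d-2)}{2}$ for all $1\le i\le d$. *)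

(* Defs.v *)
From HB Require Import structures.
From mathcomp Require Import all_boot all_order perm all_algebra.

Set Implicit Arguments.
Unset Strict Implicit.
Unset Printing Implicit Defensive.

Import GRing.Theory.
Local Open Scope ring_scope.

(* The vertices 1, ..., n are represented by the elements of 'I_n; the vertex *)
(* i : 'I_n carries the label i + 1, on which the signs of E_{m,n} depend.    *)
Definition lab n (i : 'I_n) : nat := i.+1.

Definition triple n :=
  {t : 'I_n * 'I_n * 'I_n | (lab t.1.1 < lab t.1.2 < lab t.2)%N}.

Definition t1 n (t : triple n) : 'I_n := (val t).1.1.
Definition t2 n (t : triple n) : 'I_n := (val t).1.2.
Definition t3 n (t : triple n) : 'I_n := (val t).2.

(* The inequality lab p.2 < N is strict: the equations E_{m,N} are not used   *)
(* in the coefficient matrix.                                                 *)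
Definition row_pair N := {p : 'I_N * 'I_N | (lab p.1 < lab p.2 < N)%N}.

(* The tensor power of V_d = 'rV[k]_d with factors indexed by I, in           *)
(* coordinates: f : {ffun I -> 'I_d} stands for the basis tensor              *)
(* \bigotimes_(t : I) e_(f t).                                                *)
Definition tpow (k : fieldType) (d : nat) (I : finType) :=
  {ffun {ffun I -> 'I_d} -> k^o}.

Definition stdbasis (k : fieldType) d (q : 'I_d) : 'rV[k]_d := delta_mx 0 q.

Definition pure (k : fieldType) d (I : finType) (v : I -> 'rV[k]_d) :
  tpow k d I :=
  [ffun f : {ffun I -> 'I_d} => \prod_t v t 0 (f t)].

(* The left-hand side of the vector equation E_{m,n}. The sum over r < m of   *)
(* the terms indexed by (r, m, n) is the sum over the triples with second     *)
(* component m and third component n, and similarly for the other two sums.   *)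
Definition eqn_lhs (k : fieldType) d N (v : triple N -> 'rV[k]_d)
    (m n : 'I_N) (lambda : triple N -> k) : 'rV[k]_d :=
    \sum_(t : triple N | (t2 t == m) && (t3 t == n))
       (-1) ^+ (lab (t1 t) - 1) *: (lambda t *: v t)
  + \sum_(t : triple N | (t1 t == m) && (t3 t == n))
       (-1) ^+ lab (t2 t) *: (lambda t *: v t)
  + \sum_(t : triple N | (t1 t == m) && (t2 t == n))
       (-1) ^+ (lab (t3 t) + 1) *: (lambda t *: v t).

Lemma card_triple n : #|{: triple n}| = 'C(n, 3).
Proof.
pose f (t : 3.-tuple 'I_n) := (tnth t 0, tnth t 1, tnth t 2%:R).
have f_inj : injective f.
  case=> [[|a [|b [|c []]]] //= i] [[|a' [|b' [|c' []]]] //= i'].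
  rewrite /f /tnth /= => -[-> -> ->]; exact/val_inj.
rewrite -card_ltn_sorted_tuples -(card_imset _ f_inj) card_sig cardE -cardE.
apply: eq_card => -[[a b] c]; rewrite !inE /lab /= !ltnS.
apply/idP/imsetP => [h|[[[|x [|y [|z []]]] //= i]]].
  by exists [tuple a; b; c]; rewrite // inE /= andbT.
by rewrite inE /f /tnth /= andbT => h [-> -> ->].
Qed.

Lemma card_row_pair N : #|{: row_pair N}| = 'C(N.-1, 2).
Proof.
case: N => [|N].
  by apply: eq_card0 => -[[[]]].
pose f (t : 2.-tuple 'I_N) :=
  (widen_ord (leqnSn N) (tnth t 0), widen_ord (leqnSn N) (tnth t 1)).
have f_inj : injective f.
  case=> [[|a [|b []]] //= i] [[|a' [|b' []]] //= i'].
  rewrite /f /tnth /= => -[/val_inj/= ea /val_inj/= eb].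
  by apply/val_inj; rewrite /= ea eb.
rewrite -card_ltn_sorted_tuples -(card_imset _ f_inj) card_sig.
apply: eq_card => -[a b]; rewrite !inE /lab /= !ltnS.
apply/idP/imsetP => [/andP[h hb]|[[[|x [|y []]] //= i]]].
  exists [tuple Ordinal (ltn_trans h hb); Ordinal hb].
    by rewrite inE /= h.
  by congr pair; apply/val_inj.
rewrite inE /f /tnth /= andbT => h [-> ->] /=.
by rewrite h ltn_ord.
Qed.

Definition A_dim d := (d * 'C((3 * d).-1, 2))%N.

Lemma card_cols d : #|{: triple (3 * d)}| = A_dim d.
Proof.
by apply/eqP; rewrite card_triple -(eqn_pmul2l (isT : 0 < 3)%N) -mul_bin_diag
  /A_dim mulnA.
Qed.

Lemma card_rows d : #|{: row_pair (3 * d) * 'I_d}| = A_dim d.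
Proof. by rewrite card_prod card_row_pair card_ord mulnC. Qed.

(* enum_val runs through the elements in lexicographic order: see             *)
(* enum_triple_lex and enum_rows_lex.                                         *)
Definition col_triple d (j : 'I_(A_dim d)) : triple (3 * d) :=
  enum_val (cast_ord (esym (card_cols d)) j).
Definition row_eqn d (i : 'I_(A_dim d)) : row_pair (3 * d) * 'I_d :=
  enum_val (cast_ord (esym (card_rows d)) i).

(* The coefficient of the unknown lambda_t in the q-th scalar equation of the *)
(* block E_{m,n}, where t = col_triple j and ((m, n), q) = row_eqn i.         *)
Definition A_mx (k : fieldType) d (v : triple (3 * d) -> 'rV[k]_d) :
    'M[k]_(A_dim d) :=
  \matrix_(i, j)
    eqn_lhs v (val (row_eqn i).1).1 (val (row_eqn i).1).2
      (fun t => (t == col_triple j)%:R) 0 (row_eqn i).2.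

(* The linear map with prescribed values on the basis tensors; detS3_pure     *)
(* gives its value on every simple tensor.                                    *)
Definition detS3 (k : fieldType) d (x : tpow k d (triple (3 * d))) : k^o :=
  \sum_(f : {ffun triple (3 * d) -> 'I_d})
     x f * \det (A_mx (fun t => stdbasis k (f t))).

(* {set {set 'I_n}} is the type of the sets of hyperedges of hypergraphs with *)
(* vertex set 'I_n.                                                           *)
Definition complete3 n : {set {set 'I_n}} := [set e : {set 'I_n} | #|e| == 3%N].

Record dpartition (d : nat) := DPartition {
  part :> 'I_d -> {set {set 'I_(3 * d)}};
  part_disjoint : forall p q : 'I_d, p != q -> [disjoint part p & part q];
  part_cover : \bigcup_q part q = complete3 (3 * d)
}.

Definition hyperedge n (t : triple n) : {set 'I_n} := [set t1 t; t2 t; t3 t].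

Lemma part_of_ex d (H : dpartition d) (t : triple (3 * d)) :
  exists q, hyperedge t \in H q.
Proof.
suff : hyperedge t \in \bigcup_q H q by case/bigcupP => q _ h; exists q.
rewrite part_cover inE; case: t => -[[a b] c] /= h; have /andP[h1 h2] := h.
rewrite /hyperedge /t1 /t2 /t3 /= -setUA cardsU1 cards2 !inE negb_or.
rewrite -!(inj_eq val_inj) /=.
move: h1 h2; rewrite /lab !ltnS => h1 h2.
by rewrite !neq_ltn h1 h2 (ltn_trans h1 h2).
Qed.

Definition part_of d (H : dpartition d) (t : triple (3 * d)) : 'I_d :=
  xchoose (part_of_ex H t).

Lemma part_ofP d (H : dpartition d) (t : triple (3 * d)) q :
  (hyperedge t \in H q) = (q == part_of H t).
Proof.
have h := xchooseP (part_of_ex H t).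
apply/idP/eqP => [hq|->//]; apply/eqP/negPn/negP => /(part_disjoint H).
by move=> /pred0P/(_ (hyperedge t)); rewrite /= hq h.
Qed.

Definition omega (k : fieldType) d (H : dpartition d) :
    tpow k d (triple (3 * d)) :=
  pure (fun t => stdbasis k (part_of H t)).

Definition Es n (s : nat) (H : {set {set 'I_n}}) : {set {set 'I_n}} :=
  [set f : {set 'I_n} | (#|f| == s) && [exists e in H, f \subset e]].

Definition pre_homogeneous d (H : dpartition d) : Prop :=
  forall q : 'I_d,
    #|Es 1 (H q)| = (3 * d)%N /\
    #|Es 2 (H q)| = ((3 * d) * (3 * d - 1) %/ 2)%N.

Definition homogeneous d (H : dpartition d) : Prop :=
  pre_homogeneous H /\
  forall q : 'I_d, #|Es 3 (H q)| = ((3 * d - 1) * (3 * d - 2) %/ 2)%N.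

Lemma detS3_is_linear (k : fieldType) d : scalar (@detS3 k d).
Proof.
move=> a x y; rewrite /detS3 big_distrr -big_split; apply: eq_bigr => f _ /=.
by rewrite !ffunE mulrDl mulrA.
Qed.

HB.instance Definition _ (k : fieldType) d :=
  GRing.isLinear.Build k (tpow k d (triple (3 * d))) k^o _ (@detS3 k d)
    (@detS3_is_linear k d).

Lemma eqn_lhs_delta (k : fieldType) d N m n (t : triple N) :
  exists c : k, forall v : triple N -> 'rV[k]_d,
    eqn_lhs v m n (fun u => (u == t)%:R) = c *: v t.
Proof.
have H (P : pred (triple N)) (F : triple N -> k) :
    exists c : k, forall v : triple N -> 'rV[k]_d,
    \sum_(u | P u) F u *: ((u == t)%:R *: v u) = c *: v t.
  exists (if P t then F t else 0) => v; rewrite big_mkcond (bigD1 t) //=.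
  rewrite big1 ?addr0 => [|u /negPf->]; last by rewrite scale0r scaler0 if_same.
  by rewrite eqxx scale1r; case: (P t); rewrite ?scale0r.
rewrite /eqn_lhs.
have [c1 h1] := H (fun t => (t2 t == m) && (t3 t == n))
  (fun t => (-1) ^+ (lab (t1 t) - 1)).
have [c2 h2] := H (fun t => (t1 t == m) && (t3 t == n))
  (fun t => (-1) ^+ lab (t2 t)).
have [c3 h3] := H (fun t => (t1 t == m) && (t2 t == n))
  (fun t => (-1) ^+ (lab (t3 t) + 1)).
by exists (c1 + c2 + c3) => v; rewrite h1 h2 h3 !scalerDl.
Qed.

Lemma col_triple_bij d : bijective (@col_triple d).
Proof.
apply: bij_comp; first exact: enum_val_bij.
by exists (cast_ord (card_cols d)) => x; rewrite ?cast_ordK ?cast_ordKV.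
Qed.

Lemma A_mxE (k : fieldType) d (i j : 'I_(A_dim d)) :
  exists c : k, forall v : triple (3 * d) -> 'rV[k]_d,
    A_mx v i j = c * v (col_triple j) 0 (row_eqn i).2.
Proof.
have [c hc] := eqn_lhs_delta k d (val (row_eqn i).1).1 (val (row_eqn i).1).2
  (col_triple j).
by exists c => v; rewrite mxE hc mxE.
Qed.

Lemma detS3_pure (k : fieldType) d (v : triple (3 * d) -> 'rV[k]_d) :
  detS3 (pure v) = \det (A_mx v).
Proof.
have E (w : triple (3 * d) -> 'rV[k]_d) : \det (A_mx w) =
    \sum_(s : 'S_(A_dim d)) (-1) ^+ s * \prod_j A_mx w (s j) j.
  by rewrite -det_tr; apply: eq_bigr => s _; congr (_ * _);
    apply: eq_bigr => j _; rewrite mxE.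
have [g colK gK] := col_triple_bij d.
rewrite E /detS3; under eq_bigr do rewrite E ffunE big_distrr /=.
rewrite exchange_big; apply: eq_bigr => s _ /=.
under eq_bigr do rewrite mulrCA; rewrite -big_distrr /=; congr (_ * _).
pose B (w : triple (3 * d) -> 'rV[k]_d) t := A_mx w (s (g t)) (g t).
have BE w : \prod_j A_mx w (s j) j = \prod_t B w t.
  by rewrite (reindex (@col_triple d)) /=; [apply: eq_bigr => j _;
    rewrite /B colK | exists g => ? _; [exact: colK | exact: gK]].
transitivity (\sum_(f : {ffun triple (3 * d) -> 'I_d}) \prod_t
    (v t 0 (f t) * B (fun=> stdbasis k (f t)) t)).
  apply: eq_bigr => f _; rewrite big_split BE /=; congr (_ * _).
  apply: eq_bigr => t _; rewrite /B.
  by have [c hc] := A_mxE k (s (g t)) (g t); rewrite !hc gK.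
rewrite BE -(bigA_distr_bigA (fun t q => v t 0 q * B (fun=> stdbasis k q) t)).
apply: eq_bigr => t _; rewrite /B.
have [c hc] := A_mxE k (s (g t)) (g t); rewrite hc gK.
under eq_bigr do rewrite hc [stdbasis _ _ _ _]mxE eqxx /=.
rewrite (bigD1 (row_eqn (s (g t))).2) //= eqxx mulr1 mulrC.
rewrite big1 ?addr0 // => q /negPf h.
by rewrite eq_sym h !mulr0.
Qed.

Definition lexi (S T : eqType) (r1 : rel S) (r2 : rel T) : rel (S * T) :=
  fun x y => r1 x.1 y.1 || (x.1 == y.1) && r2 x.2 y.2.

Definition ltI n : rel 'I_n := fun i j => (i < j)%N.

Lemma pairwise_enum_ord n : pairwise (@ltI n) (enum 'I_n).
Proof.
have := iota_ltn_sorted 0 n.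
by rewrite sorted_pairwise -?val_enum_ord ?pairwise_map //; exact: ltn_trans.
Qed.

Lemma pairwise_enum_prod (S T : finType) (r1 : rel S) (r2 : rel T) :
    pairwise r1 (enum S) -> pairwise r2 (enum T) ->
  pairwise (lexi r1 r2) (enum {: S * T}).
Proof.
move=> + h2; have -> : enum {: S * T} = prod_enum S T by rewrite enumT unlock.
rewrite /prod_enum; elim: (enum S) => //= x s1 IH /andP[/allP hx /IH h1].
rewrite pairwise_cat h1 andbT pairwise_map; apply/andP; split.
  apply/allrelP => p q /mapP[y _ ->] /allpairsP[[z w] /= [hz _ ->]] /=.
  by rewrite /lexi /= hx.
by apply: sub_pairwise h2 => y z yz; rewrite /lexi /= eqxx yz orbT.
Qed.

Lemma pairwise_enum_sig (T : finType) (P : pred T) (r : rel T) :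
  pairwise r (enum T) -> pairwise (relpre val r) (enum {: {x | P x}}).
Proof.
move=> h; rewrite -pairwise_map [enum {: {x | P x}}]enumT unlock /=.
rewrite pmap_filter; last exact: insubK.
by apply: subseq_pairwise h; rewrite -enumT filter_subseq.
Qed.

Lemma enum_triple_lex n :
  pairwise (relpre val (lexi (lexi (@ltI n) (@ltI n)) (@ltI n)))
    (enum {: triple n}).
Proof.
by apply: pairwise_enum_sig; do !apply: pairwise_enum_prod;
  exact: pairwise_enum_ord.
Qed.

Lemma enum_rows_lex N d :
  pairwise (lexi (relpre val (lexi (@ltI N) (@ltI N))) (@ltI d))
    (enum {: row_pair N * 'I_d}).
Proof.
apply: pairwise_enum_prod; last exact: pairwise_enum_ord.
by apply: pairwise_enum_sig; apply: pairwise_enum_prod;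
  exact: pairwise_enum_ord.
Qed.

(* Main.v *)
Require Import Defs.
From mathcomp Require Import all_boot all_order all_algebra.
From mathcomp Require Import perm ring zify.

Import GRing.Theory.
Local Open Scope ring_scope.

(** Every nonzero entry of the matrix in a row of coordinate q lies in a column
    whose triple belongs to H_q and contains the pair of the row. A nonzero
    term of the Leibniz expansion matches the rows of coordinate q with the
    hyperedges of H_q, so there are C(3d-1,2) of these, and each pair avoiding
    the last vertex N lies in some hyperedge of H_q. For a pair {m,N}: up to
    signs the equations E_{a,b} form the simplicial boundary of a 2-chain, so
    the boundary of a boundary being zero is, at the vertex m, a linear relation
    between the E_{m,n}. If no hyperedge of H_q contained {m,N}, the term
    E_{m,N} would drop out of its q-th coordinate, leaving a nontrivial
    relation between the rows of the matrix. *)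

(** * Signed incidence of pairs with triples *)

(** Labels exceed ordinals by one, so the signs of [eqn_lhs] become [+, -, +] times the parity of
    the omitted vertex. This is the simplicial boundary once pairs and triples are rescaled by the
    parity of their vertex sums. *)
Definition incidence (k : fieldType) {n} (p : 'I_n * 'I_n) (t : triple n) : k :=
  (p == (t2 t, t3 t))%:R * (-1) ^+ t1 t
  - (p == (t1 t, t3 t))%:R * (-1) ^+ t2 t
  + (p == (t1 t, t2 t))%:R * (-1) ^+ t3 t.

Lemma eqn_lhs_incidence (k : fieldType) d n (v : triple n -> 'rV[k]_d)
    (a b : 'I_n) (t : triple n) :
  eqn_lhs v a b (fun u => (u == t)%:R) = incidence k (a, b) t *: v t.
Proof.
have sum_delta (P : pred (triple n)) (F : triple n -> k) :
    \sum_(u | P u) F u *: ((u == t)%:R *: v u) = ((P t)%:R * F t) *: v t.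
  rewrite big_mkcond (bigD1 t) //= big1 => [|u /negPf ->]; last first.
    by rewrite scale0r scaler0 if_same.
  by rewrite eqxx scale1r addr0; case: (P t); rewrite ?mul1r // mul0r scale0r.
rewrite /eqn_lhs !sum_delta -!scalerDl /incidence /lab !xpair_eqE.
rewrite !(eq_sym a) !(eq_sym b) subn1 /= addn1 !exprS !mulN1r opprK.
by rewrite mulrN.
Qed.

Lemma sum_incidence (k : fieldType) n (F : 'I_n * 'I_n -> k) (t : triple n) :
  \sum_p F p * incidence k p t =
  F (t2 t, t3 t) * (-1) ^+ t1 t - F (t1 t, t3 t) * (-1) ^+ t2 t
  + F (t1 t, t2 t) * (-1) ^+ t3 t.
Proof.
have sum_delta (q : 'I_n * 'I_n) c :
    \sum_p F p * ((p == q)%:R * c) = F q * c :> k.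
  rewrite (bigD1 q) //= eqxx mul1r big1 ?addr0 // => p /negPf ->.
  by rewrite mul0r mulr0.
rewrite -!sum_delta -sumrB -big_split.
by apply: eq_bigr => p _; rewrite /incidence /=; ring.
Qed.

Lemma triple_lt {n} (t : triple n) : (t1 t < t2 t < t3 t)%N.
Proof. exact: (valP t). Qed.

Lemma incidence_neq0 {k : fieldType} {n} {p : 'I_n * 'I_n} {t : triple n} :
  incidence k p t != 0 ->
  [/\ p.1 \in hyperedge t, p.2 \in hyperedge t & (p.1 < p.2 <= t3 t)%N].
Proof.
have /andP[lt12 lt23] := triple_lt t.
rewrite /incidence /hyperedge !inE.
case: (p =P (t2 t, t3 t)) => [-> _|_] /=.
  by rewrite !eqxx !orbT lt23 leqnn.
case: (p =P (t1 t, t3 t)) => [-> _|_] /=.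
  by rewrite !eqxx !orbT (ltn_trans lt12 lt23) leqnn.
case: (p =P (t1 t, t2 t)) => [-> _|_] /=.
  by rewrite !eqxx !orbT lt12 ltnW.
by rewrite !mul0r subr0 addr0 eqxx.
Qed.

(* The coefficients of the relation between the equations E_{m,n} at the
   vertex m. *)
Definition star_weight (k : fieldType) {n} (m : 'I_n) (p : 'I_n * 'I_n) : k :=
  (p.1 == m)%:R * (-1) ^+ p.2 - (p.2 == m)%:R * (-1) ^+ p.1.

(** If [m] is a vertex of [t], exactly two faces of [t] contain it and their contributions cancel;
    otherwise every weight is zero. *)
Lemma sum_star_weight (k : fieldType) n (m : 'I_n) (t : triple n) :
  \sum_p star_weight k m p * incidence k p t = 0.
Proof. by rewrite sum_incidence /star_weight /=; ring. Qed.

(** * Nonzero Leibniz terms and the size of each class *)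

Lemma A_mx_stdbasis (k : fieldType) d (f : triple (3 * d) -> 'I_d)
    (i j : 'I_(A_dim d)) :
  A_mx (fun t => stdbasis k (f t)) i j =
  incidence k (val (row_eqn i).1) (col_triple j)
  * ((row_eqn i).2 == f (col_triple j))%:R.
Proof.
by rewrite mxE eqn_lhs_incidence !mxE eqxx -surjective_pairing.
Qed.

Lemma row_eqn_bij d : bijective (@row_eqn d).
Proof.
apply: bij_comp; first exact: enum_val_bij.
by exists (cast_ord (card_rows d)) => x; rewrite ?cast_ordK ?cast_ordKV.
Qed.

Lemma det_neq0_perm {k : fieldType} {n} (A : 'M[k]_n) :
  \det A != 0 -> exists s : 'S_n, forall i, A i (s i) != 0.
Proof.
move=> detA.
suff /existsP[s /forallP As] : [exists s : 'S_n, [forall i, A i (s i) != 0]].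
  by exists s.
apply: contraNT detA; rewrite negb_exists => /forallP noperm.
apply/eqP/big1 => s _; have /forallPn[i /negPn/eqP Ai0] := noperm s.
by rewrite (bigD1 i) //= Ai0 mul0r mulr0.
Qed.

Lemma card_class {k : fieldType} {d} (f : triple (3 * d) -> 'I_d) (q : 'I_d) :
  \det (A_mx (fun t => stdbasis k (f t))) != 0 ->
  #|[set t | f t == q]| = 'C((3 * d).-1, 2).
Proof.
move=> /det_neq0_perm[s As].
have fs i : f (col_triple (s i)) = (row_eqn i).2.
  have := As i; rewrite A_mx_stdbasis mulf_eq0 negb_or => /andP[_].
  by case: (_ =P f _) => [<-|_] //=; rewrite eqxx.
have [g rowK gK] := row_eqn_bij d.
have inj : injective (fun x => col_triple (s (g x))).
  apply: inj_comp (bij_inj (col_triple_bij d)) _.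
  by apply: inj_comp perm_inj (can_inj gK).
have pair_inj : injective (fun p : row_pair (3 * d) => (p, q)) by move=> ? ? [].
(* The matching carries the rows of coordinate [q], one for each row pair, bijectively onto the
   triples of class [q]. *)
rewrite -card_row_pair -cardsT -(card_imset _ pair_inj) -(card_imset _ inj).
apply: eq_card => t; apply/idP/imsetP => [|[_ /imsetP[p _ ->] ->]].
  rewrite inE => /eqP ft; have [h hK colK] := col_triple_bij d.
  pose x := row_eqn ((s^-1)%g (h t)).
  have gx : col_triple (s (g x)) = t by rewrite /x rowK permKV colK.
  exists x => //; apply/imsetP; exists x.1 => //.
  by rewrite -ft -gx fs gK -surjective_pairing.
by rewrite inE fs gK.
Qed.

(** * Covering of pairs of vertices by each class *)

Lemma pair_covered_row {k : fieldType} {d} (f : triple (3 * d) -> 'I_d)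
    (q : 'I_d) (a b : 'I_(3 * d)) :
  \det (A_mx (fun t => stdbasis k (f t))) != 0 -> (a < b < (3 * d).-1)%N ->
  exists t, [/\ f t = q, a \in hyperedge t & b \in hyperedge t].
Proof.
move=> /det_neq0_perm[s As] /andP[ltab ltb].
have row_ab : (lab a < lab b < 3 * d)%N by rewrite /lab; lia.
have [g _ gK] := row_eqn_bij d.
(* The Leibniz term selects a nonzero entry in the row [((a, b), q)]; its column is the required
   triple. *)
have := As (g (exist _ (a, b) row_ab, q)).
rewrite A_mx_stdbasis gK mulf_eq0 negb_or /=.
set t := col_triple _ => /andP[/incidence_neq0[at_ bt _]].
by case: (_ =P f _) => [->|_] /=; [exists t | rewrite eqxx].
Qed.

Lemma pair_covered_last {k : fieldType} {d} (f : triple (3 * d) -> 'I_d)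
    (q : 'I_d) (m l : 'I_(3 * d)) :
  \det (A_mx (fun t => stdbasis k (f t))) != 0 ->
  (m < l)%N -> l = (3 * d).-1 :> nat ->
  exists t, [/\ f t = q, m \in hyperedge t & l \in hyperedge t].
Proof.
move=> detA ltml l_last.
suff /existsP[t /and3P[/eqP]] :
    [exists t, [&& f t == q, m \in hyperedge t & l \in hyperedge t]].
  by exists t.
apply: contraT; rewrite negb_exists => /forallP uncovered.
(* The star relation at [m], placed on the rows of coordinate [q], will be a nonzero vector of the
   left kernel. *)
case/det0P: detA.
pose w (x : row_pair (3 * d) * 'I_d) : k :=
  (x.2 == q)%:R * star_weight k m (val x.1).
have [g rowK gK] := row_eqn_bij d.
exists (\row_i w (row_eqn i)).
  (* It is nonzero: there are at least three vertices, so some [n] other than [m] lies below [l],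
     and the row of the pair [m], [n] has weight [1] or [-1]. *)
  have [n nm nl] : exists2 n : 'I_(3 * d), n != m & (n < l)%N.
    have d_gt0 : (0 < 3 * d)%N by lia.
    have d_gt1 : (1 < 3 * d)%N by lia.
    have [m0|mn0] := eqVneq (m : nat) 0%N.
      by exists (Ordinal d_gt1); rewrite -?val_eqE /= ?m0; lia.
    by exists (Ordinal d_gt0); rewrite -?val_eqE /= 1?eq_sym //; lia.
  have [p wp] : exists p : row_pair (3 * d), star_weight k m (val p) != 0.
    case: (ltngtP m n) nm => [lt|lt|/val_inj->]; last by rewrite eqxx.
      have mnP : (lab m < lab n < 3 * d)%N by rewrite /lab; lia.
      move=> /negPf nm; exists (exist _ (m, n) mnP).
      by rewrite /star_weight /= eqxx nm mul0r mul1r subr0 signr_eq0.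
    have nmP : (lab n < lab m < 3 * d)%N by rewrite /lab; lia.
    move=> /negPf nm; exists (exist _ (n, m) nmP).
    by rewrite /star_weight /= eqxx nm mul0r mul1r sub0r oppr_eq0 signr_eq0.
  apply/eqP => /rowP/(_ (g (p, q))); rewrite !mxE gK /w eqxx mul1r /=.
  exact/eqP.
apply/rowP => j; rewrite !mxE.
set t := col_triple j.
transitivity (\sum_(x : row_pair (3 * d) * 'I_d)
    w x * (incidence k (val x.1) t * (x.2 == f t)%:R)).
  rewrite [RHS](reindex (@row_eqn d)) /=; last by exists g => ? _.
  by apply: eq_bigr => i _; rewrite A_mx_stdbasis mxE.
(* The vector is supported on coordinate [q], so it kills the columns of all other classes. *)
have [ftq|ftNq] := eqVneq (f t) q; last first.
  rewrite big1 // => x _; rewrite /w.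
  have [->|_] := eqVneq x.2 q; last by rewrite !mul0r.
  by rewrite eq_sym (negPf ftNq) !mulr0.
transitivity (\sum_(p : row_pair (3 * d))
    star_weight k m (val p) * incidence k (val p) t).
  rewrite -(pair_bigA _ (fun p c => w (p, c) *
    (incidence k (val p) t * (c == f t)%:R))) /=.
  apply: eq_bigr => p _; rewrite (bigD1 q) //= big1 => [|c /negPf cq].
    by rewrite /w /= ftq eqxx mul1r mulr1 addr0.
  by rewrite /w /= cq !mul0r.
have [mt|mNt] := boolP (m \in hyperedge t); last first.
  rewrite big1 // => p _; apply/eqP; rewrite mulf_eq0 orbC.
  apply: contraR mNt; rewrite negb_or => /andP[/incidence_neq0[p1t p2t _]].
  rewrite /star_weight; case: ((val p).1 =P m) => [<- //|_].
  by case: ((val p).2 =P m) => [<- //|_]; rewrite !mul0r subr0 eqxx.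
(* Since [t] contains [m], it avoids [l] by assumption, so all its pairs index rows. *)
have t3l : (t3 t < l)%N.
  have := uncovered t; rewrite ftq eqxx mt /= => lNt.
  rewrite ltn_neqAle l_last -ltnS prednK ?ltn_ord; last by lia.
  rewrite andbT; apply: contra lNt; rewrite -l_last => /eqP/val_inj <-.
  by rewrite /hyperedge !inE eqxx orbT.
(* Pairs that index no row have zero incidence with [t], so the sum extends to all pairs, where the
   star relation applies. *)
rewrite -[RHS](sum_star_weight k _ m t).
rewrite [RHS](bigID (fun p => lab p.1 < lab p.2 < 3 * d)%N) /=.
rewrite [X in _ = _ + X]big1 ?addr0 => [|p pN]; last first.
  apply/eqP; rewrite mulf_eq0 orbC; apply: contraR pN.
  by rewrite negb_or => /andP[/incidence_neq0[_ _ ?] _]; rewrite /lab; lia.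
by rewrite (big_sub [pred p : 'I_(3 * d) * 'I_(3 * d) |
  lab p.1 < lab p.2 < 3 * d]%N).
Qed.

Lemma pair_covered {k : fieldType} {d} (f : triple (3 * d) -> 'I_d) (q : 'I_d)
    (a b : 'I_(3 * d)) :
  \det (A_mx (fun t => stdbasis k (f t))) != 0 -> a != b ->
  exists t, [/\ f t = q, a \in hyperedge t & b \in hyperedge t].
Proof.
move=> detA; wlog ltab : a b / (a < b)%N => [covered ab|_].
  have := ab; rewrite -val_eqE neq_ltn => /orP[/covered|lt_ba]; first exact.
  rewrite eq_sym in ab.
  by have [t [ft bt at_]] := covered _ _ lt_ba ab; exists t.
have [ltb|geb] := ltnP b (3 * d).-1.
  by apply: (pair_covered_row f q _ _ detA); rewrite ltab.
by apply: (pair_covered_last f q _ _ detA ltab); have := ltn_ord b; lia.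
Qed.

(** * Increasing triples and hyperedges *)

Lemma hyperedge_inj {n} : injective (@hyperedge n).
Proof.
move=> t u; have := triple_lt t; have := triple_lt u.
rewrite /hyperedge; case: t u => [[[a b] c] ht] [[[x y] z] hu].
rewrite /t1 /t2 /t3 /= => xyz abc /setP E; apply/val_inj => /=.
(* The six memberships and the two increasing orders force equality of the components. *)
move: (E a) (E b) (E c) (E x) (E y) (E z).
rewrite !inE !eqxx ?orbT -!val_eqE /= => Ea Eb Ec Ex Ey Ez.
suff [-> -> ->] : [/\ a = x, b = y & c = z] by [].
by split; apply/val_inj => /=; lia.
Qed.

(** The increasing enumeration of [e] supplies the triple. *)
Lemma hyperedge_surj {n} (e : {set 'I_n}) :
  #|e| = 3%N -> exists t : triple n, hyperedge t = e.
Proof.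
move=> e3; have := mem_enum e; have : sorted (@ltI n) (enum e).
  rewrite sorted_pairwise; last by move=> ? ? ?; exact: ltn_trans.
  apply: subseq_pairwise (pairwise_enum_ord n).
  by rewrite enumT; exact: filter_subseq.
have : size (enum e) = 3%N by rewrite -cardE.
case: (enum e) => [|a [|b [|c []]]] //= _ /and3P[ab bc _] mem_e.
have abc : (lab a < lab b < lab c)%N by rewrite /lab !ltnS; apply/andP.
exists (exist _ (a, b, c) abc); apply/setP => x.
by rewrite -mem_e /hyperedge !inE orbA.
Qed.

Lemma card_part d (H : dpartition d) q :
  #|H q| = #|[set t | part_of H t == q]|.
Proof.
rewrite -(card_imset _ hyperedge_inj); apply: eq_card => e.
apply/idP/imsetP => [eq|[t + ->]]; last by rewrite inE part_ofP eq_sym.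
have : e \in complete3 (3 * d) by rewrite -(part_cover H); apply/bigcupP; exists q.
rewrite inE => /eqP/hyperedge_surj[t te]; exists t => //.
by rewrite inE eq_sym -part_ofP te.
Qed.

Lemma Es3_part d (H : dpartition d) q : Es 3 (H q) = H q.
Proof.
have card3 e : e \in H q -> #|e| = 3%N.
  move=> eq; apply/eqP; have : e \in complete3 (3 * d); last by rewrite inE.
  by rewrite -(part_cover H); apply/bigcupP; exists q.
apply/setP => f; rewrite inE; apply/andP/idP => [[/eqP f3 /exists_inP[e eq fe]]|fq].
  by have /eqP -> : f == e by rewrite eqEcard fe f3 card3.
by rewrite card3 //; split=> //; apply/exists_inP; exists f.
Qed.

Theorem corollary4p12 (k : fieldType) (k_char0 : [pchar k] =i pred0)
    (d : nat) (d_ge2 : (2 <= d)%N) (H : dpartition d)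
    (det_neq0 : detS3 (omega k H) != 0) :
  homogeneous H.
Proof.
move: det_neq0; rewrite /omega detS3_pure => detA.
have covered q a b : a != b -> exists2 e, e \in H q & [set a; b] \subset e.
  move=> /(pair_covered (part_of H) q _ _ detA)[t [tq at_ bt]].
  exists (hyperedge t); first by rewrite part_ofP tq.
  by rewrite subUset !sub1set at_.
split=> q; last first.
  by rewrite Es3_part card_part (card_class _ _ detA) bin2 divn2; congr _./2; lia.
(* A second vertex reduces the covering of a single vertex to that of a pair. *)
have other (a : 'I_(3 * d)) : exists b, a != b.
  have d_gt0 : (0 < 3 * d)%N by lia.
  have d_gt1 : (1 < 3 * d)%N by lia.
  have [->|] := eqVneq a (Ordinal d_gt0); last by exists (Ordinal d_gt0).
  by exists (Ordinal d_gt1).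
have card_Es s : (forall f : {set 'I_(3 * d)}, #|f| = s ->
    exists2 e, e \in H q & f \subset e) -> #|Es s (H q)| = 'C(3 * d, s).
  move=> cov; rewrite -[in RHS](card_ord (3 * d)) -card_draws.
  apply: eq_card => f; rewrite !inE; case: eqP => //= /cov[e eq fe].
  by apply/exists_inP; exists e.
split; rewrite card_Es ?bin1 ?bin2 ?divn2 ?subn1 // => f.
  move=> /eqP/cards1P[a ->]; have [b ab] := other a.
  have [e eq abe] := covered q a b ab; exists e => //.
  by apply: subset_trans abe; rewrite sub1set !inE eqxx.
by move=> /eqP/cards2P[a [b [/(covered q)]]] h ->.
Qed.
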